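(* Let $T=\{\pi_1,\ldots,\pi_m\}$ be a set of nonempty permutations, and write $\pi_i = \alpha^i_1|\alpha^i_2|\ldots|\alpha^i_{k_i}$ with $\alpha^i_1,\ldots,\alpha^i_{k_i}$ complete, for $1 \le i \le m$. Then $$F_T(x) = 1 + x F_{\beta(T)}(x) + x^2 \sum_{i_1 = 1}^{k_1}\cdots\sum_{i_m=1}^{k_m} \left( \sum_{Y \subseteq \{1,2,\ldots,m\}} (-1)^{|Y|} F_{T_Y}(x) \right) F_{T^{right}_{i_1,\ldots,i_m}}(x),$$ where, for given $i_1,\ldots,i_m$ with $1\le i_j\le k_j$ and $Y \subseteq\{1,\ldots,m\}$, $$T_Y = \left\{\overline{\alpha^j_1|\ldots|\alpha^j_{i_j-1}} : j \in Y\right\} \cup \left\{\overline{\alpha^j_1|\ldots|\alpha^j_{i_j}} : 1 \le j \le m,\ j\notin Y\right\},$$ $$T^{right}_{i_1,\ldots,i_m} = \left\{\alpha^j_{i_j}|\ldots|\alpha^j_{k_j} : 1 \le j \le m\right\}.$$ Here $\beta(\pi_i) = \pi_i$ if $\alpha^i_1 \neq 1$, $\beta(\pi_i) = \alpha^i_2|\ldots|\alpha^i_{k_i}$ if $\alpha^i_1 = 1$, and $\beta(T)$ is the set of permutations obtained by applying $\beta$ to every element of $T$.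
   Context: Permutations are written in one-line notation. A permutation $\pi$ avoids $\sigma$ if no subsequence of $\pi$ has the same relative order as $\sigma$. For a set $T$ of permutations, $I_n(3412,T)$ is the set of involutions of $\{1,\ldots,n\}$ which avoid $3412$ and every element of $T$, and $F_T(x)=\sum_{n\ge 0}|I_n(3412,T)|x^n$. Every permutation contains the empty permutation $\emptyset$, so $F_T(x)=0$ whenever $\emptyset\in T$. $|\pi|$ is the length of $\pi$; for a sequence $\sigma$ of integers, $\sigma^{+n}$ is obtained by adding $n$ to each entry. A permutation $\pi$ of $\{1,\ldots,n\}$, $n\ge1$, is complete if no initial segment of $\pi$ of length $k$ with $1\le k<n$ consists of the numbers $1,2,\ldots,k$. The notation $\alpha_1|\alpha_2|\ldots|\alpha_k$ means the permutation $\alpha_1\,\alpha_2^{+|\alpha_1|}\,\alpha_3^{+|\alpha_1|+|\alpha_2|}\cdots\alpha_k^{+|\alpha_1|+\cdots+|\alpha_{k-1}|}$ (the empty permutation if there are no factors); every permutation is uniquely of this form with all $\alpha_i$ complete. For a permutation $\pi$, $\overline{\pi}$ is defined by: (1) $\overline{\emptyset}=\overline{1}=\emptyset$; (2) if $|\pi|\ge2$ and $\pi=|\pi|\,\sigma^{+1}\,1$ for a permutation $\sigma$, then $\overline{\pi}=\sigma$; (3) if $|\pi|\ge2$ and $\pi=|\pi|\,\sigma$ for a permutation $\sigma$ which does not end with $1$, then $\overline{\pi}=\sigma$; (4) if $|\pi|\ge2$, $\pi=\sigma^{+1}\,1$ for a permutation $\sigma$, and $\pi$ does not begin with $|\pi|$,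 then $\overline{\pi}=\sigma$; (5) if $|\pi|\ge2$, $\pi$ does not begin with $|\pi|$ and does not end with $1$, then $\overline{\pi}=\pi$. *)

(* Defs.v *)
From HB Require Import structures.
From mathcomp Require Import all_boot all_order all_algebra all_fingroup.
From mathcomp Require Import finmap.
From mathcomp Require Import boolp.

Set Implicit Arguments.
Unset Strict Implicit.
Unset Printing Implicit Defensive.

Import GRing.Theory.

Local Open Scope nat_scope.

(* A permutation of 1..n is represented by its one-line notation, a word over
   nat; values start at 1, while positions (nth, take, drop) start at 0. *)

Definition is_perm (s : seq nat) : bool := perm_eq s (iota 1 (size s)).

Definition shift (n : nat) (s : seq nat) : seq nat := [seq n + x | x <- s].

Definition same_order (s t : seq nat) : bool :=
  (size s == size t) &&
  [forall i : 'I_(size s), forall j : 'I_(size s),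
     (nth 0 s i < nth 0 s j) == (nth 0 t i < nth 0 t j)].

Definition contains (p s : seq nat) : bool :=
  [exists b : (size p).-tuple bool, same_order (mask b p) s].

Definition avoids (p s : seq nat) : bool := ~~ contains p s.

Definition complete (p : seq nat) : bool :=
  [&& is_perm p, 0 < size p &
      [forall k : 'I_(size p),
         (0 < k) ==> ~~ perm_eq (take k p) (iota 1 k)]].

(* alpha_1|alpha_2|...|alpha_k *)
Definition bars (a : seq (seq nat)) : seq nat :=
  flatten (mkseq (fun i => shift (sumn (map size (take i a))) (nth [::] a i))
                 (size a)).

(* The decomposition of a permutation into complete permutations is unique, so
   beta is given on the list of complete factors. *)
Definition beta (a : seq (seq nat)) : seq nat :=
  if head [::] a == [:: 1] then bars (behead a) else bars a.

(* For a permutation p of 1..n, the rest of p after removing a leading n, and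
   the rest lowered by 1 after removing a trailing 1, are automatically
   permutations; see the lemmas overline1 to overline5. *)
Definition overline (p : seq nat) : seq nat :=
  if size p < 2 then [::] else
  match head 0 p == size p, last 0 p == 1 with
  | true, true => map predn (behead (take (size p).-1 p))
  | true, false => behead p
  | false, true => map predn (take (size p).-1 p)
  | false, false => p
  end.

Lemma predn_shift1 s : map predn (shift 1 s) = s.
Proof. by rewrite /shift -map_comp map_id_in. Qed.

Lemma overline1 : overline [::] = [::] /\ overline [:: 1] = [::].
Proof. by []. Qed.

Lemma overline2 s : overline ((size s).+2 :: rcons (shift 1 s) 1) = s.
Proof.
rewrite /overline /= size_rcons size_map eqxx last_rcons /= -cats1.
by rewrite take_size_cat ?size_map // predn_shift1.
Qed.

Lemma overline3 s : 0 < size s -> last 0 s != 1 ->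
  overline ((size s).+1 :: s) = s.
Proof. by case: s => // x s _ /= /negbTE H; rewrite /overline /= eqxx H. Qed.

Lemma overline4 s : 0 < size s -> head 0 (shift 1 s) != (size s).+1 ->
  overline (rcons (shift 1 s) 1) = s.
Proof.
case: s => // x s _ /= /negbTE H.
rewrite /overline /= size_rcons size_map H last_rcons /= -cats1.
by rewrite take_size_cat ?size_map //= predn_shift1.
Qed.

Lemma overline5 p : 1 < size p -> head 0 p != size p -> last 0 p != 1 ->
  overline p = p.
Proof.
by rewrite /overline ltnNge -ltnS => /negbTE -> /negbTE -> /negbTE ->.
Qed.

(* One-line notation of s, with the values 0..n-1 raised to 1..n. *)
Definition word n (s : 'S_n) : seq nat := [seq (s i).+1 | i : 'I_n].

Definition invol_avoiding (n : nat) (T : {fset seq nat}) : {set 'S_n} :=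
  [set s : 'S_n | [&& (s * s == 1)%g, avoids (word s) [:: 3; 4; 1; 2] &
                      [forall t : T, avoids (word s) (val t)]]].

Local Open Scope ring_scope.

Record fps : Type := Fps { fps_coef : nat -> int }.

Lemma fpsP (f g : fps) : fps_coef f =1 fps_coef g -> f = g.
Proof. by case: f; case: g => f g /= /funext ->. Qed.

HB.instance Definition _ := gen_eqMixin fps.
HB.instance Definition _ := gen_choiceMixin fps.

Definition fps_zero := Fps (fun _ => 0).
Definition fps_opp (f : fps) := Fps (fun n => - fps_coef f n).
Definition fps_add (f g : fps) := Fps (fun n => fps_coef f n + fps_coef g n).
Definition fps_one := Fps (fun n => (n == 0%N)%:R).
Definition fps_mul (f g : fps) :=
  Fps (fun n => \sum_(i < n.+1) fps_coef f i * fps_coef g (n - i)%N).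

Lemma fps_addA : associative fps_add.
Proof. by move=> f g h; apply: fpsP => n /=; rewrite addrA. Qed.
Lemma fps_addC : commutative fps_add.
Proof. by move=> f g; apply: fpsP => n /=; rewrite addrC. Qed.
Lemma fps_add0 : left_id fps_zero fps_add.
Proof. by move=> f; apply: fpsP => n /=; rewrite add0r. Qed.
Lemma fps_addN : left_inverse fps_zero fps_opp fps_add.
Proof. by move=> f; apply: fpsP => n /=; rewrite addNr. Qed.

HB.instance Definition _ :=
  GRing.isZmodule.Build fps fps_addA fps_addC fps_add0 fps_addN.

Lemma fps_coef_mulE (N n : nat) (f g : fps) : (n < N)%N ->
  fps_coef (fps_mul f g) n =
  (\poly_(i < N) fps_coef f i * \poly_(i < N) fps_coef g i)`_n.
Proof.
move=> nN; rewrite coefM; apply: eq_bigr => i _.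
by rewrite !coef_poly (leq_ltn_trans (leq_subr _ _) nN)
           (leq_ltn_trans _ nN) // -ltnS.
Qed.

Lemma fps_mulC : commutative fps_mul.
Proof.
by move=> f g; apply: fpsP => n; rewrite !(@fps_coef_mulE n.+1) // mulrC.
Qed.

Lemma fps_mulA : associative fps_mul.
Proof.
move=> f g h; apply: fpsP => n.
pose t (u : fps) := \poly_(i < n.+1) fps_coef u i.
have trM u v w :
    (t (fps_mul u v) * t w)`_n = (t u * t v * t w)`_n.
  rewrite [LHS]coefM [RHS]coefM; apply: eq_bigr => i _; congr (_ * _).
  by rewrite coef_poly ltn_ord (@fps_coef_mulE n.+1).
rewrite [LHS](congr1 (fun u => fps_coef u n) (fps_mulC _ _)).
rewrite !(@fps_coef_mulE n.+1) // trM trM.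
by congr (_`_n); rewrite mulrC mulrA.
Qed.

Lemma fps_mul1 : left_id fps_one fps_mul.
Proof.
move=> f; apply: fpsP => n /=; rewrite big_ord_recl /= mul1r subn0.
by rewrite big1 ?addr0 // => i _; rewrite mul0r.
Qed.

Lemma fps_mulDl : left_distributive fps_mul fps_add.
Proof.
move=> f g h; apply: fpsP => n /=; rewrite -big_split /=.
by apply: eq_bigr => i _; rewrite mulrDl.
Qed.

Lemma fps_one_neq0 : fps_one != 0.
Proof. by apply/eqP => /(congr1 (fun f => fps_coef f 0)). Qed.

HB.instance Definition _ := GRing.Zmodule_isComNzRing.Build fps
  fps_mulA fps_mulC fps_mul1 fps_mulDl fps_one_neq0.

Definition fpsX : fps := Fps (fun n => (n == 1%N)%:R).

Definition F (T : {fset seq nat}) : fps :=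
  Fps (fun n => #|invol_avoiding n T|%:R).

Local Open Scope fset_scope.

(* The index tuples (i_1,...,i_m).  Indices start at 0 here: i j stands for
   i_j - 1, so that take (i j), take (i j).+1 and drop (i j) select the factors
   1..i_j-1, 1..i_j and i_j..k_j respectively. *)
Notation index_tuple alpha :=
  {dffun forall j, 'I_(size (alpha j))}.

Definition TY m (alpha : 'I_m -> seq (seq nat)) (i : index_tuple alpha)
    (Y : {set 'I_m}) : {fset seq nat} :=
  [fset overline (bars (take (i j) (alpha j))) | j in Y] `|`
  [fset overline (bars (take (i j).+1 (alpha j))) | j in ~: Y].

Definition Tright m (alpha : 'I_m -> seq (seq nat)) (i : index_tuple alpha) :
    {fset seq nat} :=
  [fset bars (drop (i j) (alpha j)) | j in 'I_m].

Arguments TY [m] alpha i Y.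
Arguments Tright [m] alpha i.

(* Main.v *)
Require Import Defs.
From mathcomp Require Import all_boot all_order all_algebra all_fingroup.
From mathcomp Require Import finmap.
From mathcomp Require Import zify.

(** An involution avoiding 3412 of length n+1 is a direct sum [dsum a b] of two
    such involutions, where [a] is either [1] or the bracket of a smaller one
    [t]: the word [|t|+2, t+1, 1].  Indeed, if the involution starts with [k],
    an entry above [k] among the first [k] positions would create the pattern
    3412 together with its mirror image and the pair [k ... 1]; so the first
    [k] positions are stable ([take_head_perm]), and the involution exchanges
    the ends of that initial block.  Counting by [k] ([words_by_head]) is the
    convolution behind the three summands [1], [x ...] and [x^2 ...].

    It remains to distribute the avoidance condition over [a] and [b].  The
    sum [dsum a b] contains [alpha_1|...|alpha_k] exactly when, for some [i],
    [a] contains the first [i] factors and [b] contains the others: the part of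
    an occurrence that lies in [a] is below and to the left of the rest, so it
    cannot cut a complete factor ([contains_dsum]).  Hence [dsum a b] avoids the
    pattern iff [b] avoids the suffix starting at the first factor [i] for which
    [a] avoids the first [i] factors.  That [i] is unique, and summing over its
    possible values, one for each pattern, gives the sum over [i_1,...,i_m]
    ([avoids_dsum], [sum_choice]).

    Finally, when [a] is the bracket of [t], its first and last entries can only
    play the maximum in first position and the minimum in last position of a
    pattern, so [a] contains [s] iff [t] contains [overline s]
    ([contains_bracket]); for [a = 1] the same remark gives [beta]
    ([avoids_dsum1]).  Inclusion-exclusion ([incl_excl]) turns the conditions
    that [t] contains one prefix and avoids the next one into avoidance
    conditions only, which are those of the sets [TY]. *)

Set Implicit Arguments.
Unset Strict Implicit.
Unset Printing Implicit Defensive.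

Import GRing.Theory.

(** * Occurrences of patterns and cuts of words *)

Lemma same_orderP s t :
  reflect (size s = size t /\
           forall i j, i < size s -> j < size s ->
             (nth 0 s i < nth 0 s j) = (nth 0 t i < nth 0 t j))
          (same_order s t).
Proof.
apply: (iffP andP) => [[/eqP sz /forallP h]|[sz h]].
  split=> // i j li lj.
  by have /forallP/(_ (Ordinal lj))/eqP := h (Ordinal li).
split; first exact/eqP.
by apply/forallP=> i; apply/forallP=> j; apply/eqP/h.
Qed.

Lemma containsP p s :
  reflect (exists2 u, subseq u p & same_order u s) (contains p s).
Proof.
apply: (iffP existsP) => [[b h]|[u /subseqP[b /eqP sb ->] h]].
  by exists (mask b p) => //; apply: mask_subseq.
by exists (Tuple sb).
Qed.

Lemma same_order_size s t : same_order s t -> size s = size t.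
Proof. by case/same_orderP. Qed.

Lemma same_order_sym s t : same_order s t -> same_order t s.
Proof.
by case/same_orderP=> sz h; apply/same_orderP; split=> // i j;
  rewrite -sz => li lj; rewrite h.
Qed.

Lemma same_order_trans s t u :
  same_order s t -> same_order t u -> same_order s u.
Proof.
case/same_orderP=> sz h /same_orderP[sz' h']; apply/same_orderP.
by split=> [|i j li lj]; rewrite ?sz // h // h' -?sz.
Qed.

Lemma same_order_map (f : nat -> nat) s :
  {in s &, {mono f : x y / x < y}} -> same_order (map f s) s.
Proof.
move=> fmono; apply/same_orderP; rewrite size_map; split=> // i j li lj.
by rewrite !(nth_map 0) // fmono // mem_nth.
Qed.

Lemma same_order_shift n s : same_order (shift n s) s.
Proof. by apply: same_order_map => x y _ _; rewrite ltn_add2l. Qed.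

Lemma same_order_take n s t : same_order s t -> same_order (take n s) (take n t).
Proof.
case/same_orderP=> sz h; apply/same_orderP; rewrite !size_take_min sz.
by split=> // i j; rewrite !leq_min => /andP[? ?] /andP[? ?];
  rewrite !nth_take // h ?sz.
Qed.

Lemma same_order_drop n s t : same_order s t -> same_order (drop n s) (drop n t).
Proof.
case/same_orderP=> sz h; apply/same_orderP; rewrite !size_drop sz.
by split=> // i j li lj; rewrite !nth_drop; apply: h; lia.
Qed.

(** The boolean selects the direct ([true]) or the skew ([false]) order, so that
    the cuts of direct sums and the removal of a leading maximum or of a trailing
    minimum are instances of the same lemmas. *)
Definition before (e : bool) (x y : nat) := if e then x < y else y < x.

Lemma allrel_nthP (r : rel nat) (a b : seq nat) :
  reflect (forall i j, i < size a -> j < size b -> r (nth 0 a i) (nth 0 b j))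
          (allrel r a b).
Proof.
apply: (iffP allrelP) => [h i j li lj|h x y]; first by apply: h; apply: mem_nth.
by move=> /(nthP 0)[i li <-] /(nthP 0)[j lj <-]; apply: h.
Qed.

Lemma before_same_order e s t c : same_order s t ->
  allrel (before e) (take c s) (drop c s) ->
  allrel (before e) (take c t) (drop c t).
Proof.
case/same_orderP=> sz h /allrel_nthP hs; apply/allrel_nthP=> i j.
rewrite size_take_min size_drop leq_min => /andP[ic it] jt.
have := hs i j; rewrite size_take_min size_drop leq_min ic sz it jt /=.
move=> /(_ isT isT); rewrite !nth_take // !nth_drop /before.
by rewrite !h // sz //; lia.
Qed.

Lemma same_order_cat e a b c d :
  allrel (before e) a b -> allrel (before e) c d ->
  same_order a c -> same_order b d -> same_order (a ++ b) (c ++ d).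
Proof.
move=> /allrel_nthP hab /allrel_nthP hcd /same_orderP[sa ha] /same_orderP[sb hb].
apply/same_orderP; rewrite !size_cat sa sb; split=> // i j li lj.
have cross i' j' : i' < size a -> j' < size b ->
    before e (nth 0 a i') (nth 0 b j') /\ before e (nth 0 c i') (nth 0 d j').
  by move=> *; split; [apply: hab|apply: hcd]; rewrite -?sa -?sb.
rewrite !nth_cat -sa; case: (ltnP i) => hi; case: (ltnP j) => hj.
- exact: ha.
- by have := cross i (j - size a); rewrite /before; case: (e); lia.
- by have := cross j (i - size a); rewrite /before; case: (e); lia.
- by apply: hb; lia.
Qed.

(** An occurrence in [a ++ b] restricts to an occurrence in [a] and one in [b];
    conversely these glue together, because the order between the two parts is
    the same in the word and in the pattern. *)
Lemma contains_cat e a b s : allrel (before e) a b ->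
  contains (a ++ b) s <->
  exists c, [/\ c <= size s, allrel (before e) (take c s) (drop c s),
                contains a (take c s) & contains b (drop c s)].
Proof.
move=> hab; split=> [/containsP[u /subseqP[m sm ->]]|[c [cs hs]]].
  rewrite -(cat_take_drop (size a) m) mask_cat; last first.
    by rewrite size_takel // sm size_cat leq_addr.
  set u1 := mask _ a; set u2 := mask _ b => h.
  have s1 : subseq u1 a := mask_subseq _ _.
  have s2 : subseq u2 b := mask_subseq _ _.
  exists (size u1); split.
  - by rewrite -(same_order_size h) size_cat leq_addr.
  - apply: (before_same_order h).
    rewrite take_size_cat // drop_size_cat //.
    apply/allrelP=> x y /(mem_subseq s1) xa /(mem_subseq s2) yb.
    by apply: (allrelP hab).
  - apply/containsP; exists u1 => //.
    by rewrite -[X in same_order X](take_size_cat u2 (erefl (size u1)));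
      apply: same_order_take.
  - apply/containsP; exists u2 => //.
    by rewrite -[X in same_order X](drop_size_cat u2 (erefl (size u1)));
      apply: same_order_drop.
case/containsP=> u1 s1 h1 /containsP[u2 s2 h2]; apply/containsP.
exists (u1 ++ u2); first exact: cat_subseq.
rewrite -(cat_take_drop c s); apply: (same_order_cat (e := e)) => //.
apply/allrelP=> x y /(mem_subseq s1) xa /(mem_subseq s2) yb.
by apply: (allrelP hab).
Qed.

Lemma contains_same_order p s t :
  same_order s t -> contains p s = contains p t.
Proof.
move=> h; apply/containsP/containsP => -[u up us]; exists u => //.
  exact: same_order_trans h.
by apply: same_order_trans us _; apply: same_order_sym.
Qed.

Lemma contains_shift n p s : contains (shift n p) s = contains p s.
Proof.
apply/containsP/containsP => -[u].
  case/subseqP=> m _ ->; rewrite /shift -map_mask => h.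
  exists (mask m p); first exact: mask_subseq.
  by apply: same_order_trans h; apply/same_order_sym/same_order_shift.
move=> up us; exists (shift n u); first exact: map_subseq.
exact: same_order_trans (same_order_shift _ _) us.
Qed.

Lemma contains0 p : contains p [::].
Proof.
by apply/containsP; exists [::]; rewrite ?sub0seq //; apply/same_orderP.
Qed.

Lemma contains_size (p s : seq nat) : contains p s -> size s <= size p.
Proof.
by case/containsP=> u /size_subseq le /same_order_size <-.
Qed.

Lemma contains_take n p s : contains p s -> contains p (take n s).
Proof.
case/containsP=> u up us; apply/containsP; exists (take n u).
  exact: subseq_trans (take_subseq _ _) up.
exact: same_order_take.
Qed.

Lemma contains_drop n p s : contains p s -> contains p (drop n s).
Proof.
case/containsP=> u up us; apply/containsP; exists (drop n u).
  exact: subseq_trans (drop_subseq _ _) up.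
exact: same_order_drop.
Qed.

(** * Permutations, direct sums and complete factors *)

Lemma is_permP (s : seq nat) :
  reflect (uniq s /\ forall x : nat, x \in s -> 0 < x <= size s) (is_perm s).
Proof.
apply: (iffP idP) => [h|[us hs]].
  split; first by rewrite (perm_uniq h) iota_uniq.
  by move=> x; rewrite (perm_mem h) mem_iota; lia.
apply: uniq_perm => //; first exact: iota_uniq.
apply: (uniq_min_size us _ _).2; last by rewrite size_iota.
by move=> x /hs; rewrite mem_iota; lia.
Qed.

Lemma is_perm_mem (s : seq nat) (x : nat) :
  is_perm s -> (x \in s) = (0 < x <= size s).
Proof. by move=> h; rewrite (perm_mem h) mem_iota; lia. Qed.

Lemma is_perm_uniq (s : seq nat) : is_perm s -> uniq s.
Proof. by case/is_permP. Qed.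

Definition dsum (a b : seq nat) : seq nat := a ++ shift (size a) b.

Lemma size_dsum a b : size (dsum a b) = size a + size b.
Proof. by rewrite size_cat size_map. Qed.

Lemma shift_iota n m k : shift n (iota m k) = iota (n + m) k.
Proof. by rewrite /shift -iotaDl. Qed.

Lemma shift_shift m n s : shift m (shift n s) = shift (m + n) s.
Proof. by rewrite /shift -map_comp; apply: eq_map => x /=; rewrite addnA. Qed.

Lemma dsumA : associative dsum.
Proof.
by move=> a b c; rewrite /dsum -catA size_cat /shift map_cat -!/(shift _ _)
  shift_shift size_map.
Qed.

Lemma dsum_before a b : is_perm a -> is_perm b ->
  allrel (before true) a (shift (size a) b).
Proof.
move=> pa pb; apply/allrelP=> x y; rewrite is_perm_mem // => xa /mapP[z].
by rewrite is_perm_mem // /before => zb ->; lia.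
Qed.

Lemma is_perm_dsumr a b : is_perm a -> is_perm (dsum a b) = is_perm b.
Proof.
move=> pa; rewrite /is_perm size_dsum iotaD (addnC 1) -shift_iota /dsum.
rewrite (perm_catr _ (pa : perm_eq a (iota 1 (size a)))) perm_cat2l.
apply/idP/idP => [|/perm_map]; last exact.
by apply: perm_map_inj => x y; lia.
Qed.

(** Below a value found among the first [c] entries there are only values found
    there, so such a value is at most [c]. *)
Lemma perm_take_before c (w : seq nat) : is_perm w -> c <= size w ->
  allrel (before true) (take c w) (drop c w) -> perm_eq (take c w) (iota 1 c).
Proof.
move=> pw cw /allrelP h.
have szt : size (take c w) = c by rewrite size_takel.
rewrite -[in iota 1 c]szt; apply/is_permP; rewrite szt.
split=> [|x xt]; first by rewrite take_uniq // is_perm_uniq.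
have := mem_take xt; rewrite is_perm_mem // => /andP[-> xw] /=.
rewrite -szt -(size_iota 1 x); apply: uniq_leq_size; first exact: iota_uniq.
move=> y; rewrite mem_iota => yx; have : y \in w by rewrite is_perm_mem //; lia.
rewrite -{1}(cat_take_drop c w) mem_cat => /orP[//|yd].
by have := h _ _ xt yd; rewrite /before; lia.
Qed.

Lemma dsum_take c (w : seq nat) : is_perm w -> is_perm (take c w) ->
  exists2 b, is_perm b & w = dsum (take c w) b.
Proof.
move=> pw pt; pose k := size (take c w); pose b := [seq x - k | x <- drop c w].
have wE : w = dsum (take c w) b.
  rewrite -{1}(cat_take_drop c w) /dsum; congr (_ ++ _).
  rewrite /shift -map_comp map_id_in // => x xd /=.
  have xnt : x \notin take c w.
    have := is_perm_uniq pw; rewrite -{1}(cat_take_drop c w) cat_uniq.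
    by case/and3P=> _ /hasPn/(_ x xd).
  move: xnt (mem_drop xd); rewrite !is_perm_mem // -/k; lia.
by exists b => //; rewrite -(is_perm_dsumr b pt) -wE.
Qed.

Lemma bars_cons a l : bars (a :: l) = dsum a (bars l).
Proof.
rewrite /bars /mkseq /= /dsum; congr (_ ++ _).
  by rewrite /shift map_id_in.
rewrite /shift map_flatten -[1]/(1 + 0) iotaDl -!map_comp; congr flatten.
apply: eq_map => i /=; rewrite -map_comp; apply: eq_map => x /=.
by rewrite addnA.
Qed.

Lemma bars_cat l1 l2 : bars (l1 ++ l2) = dsum (bars l1) (bars l2).
Proof.
elim: l1 => [|a l1 IH]; last by rewrite cat_cons !bars_cons IH dsumA.
by rewrite /dsum /shift map_id_in.
Qed.

Lemma bars_perm (l : seq (seq nat)) : all complete l -> is_perm (bars l).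
Proof.
elim: l => [//|a l IH] /= /andP[/and3P[pa _ _] /IH pl].
by rewrite bars_cons is_perm_dsumr.
Qed.

(** An initial segment that is a permutation cannot end strictly inside a
    factor: it would exhibit a proper initial permutation of that factor. *)
Lemma take_bars_perm (l : seq (seq nat)) c :
  all complete l -> c <= size (bars l) ->
  is_perm (take c (bars l)) ->
  exists i, [/\ i <= size l, take c (bars l) = bars (take i l)
              & drop c (bars l) = shift c (bars (drop i l))].
Proof.
elim: l c => [|a l IH] c /= => [_|/andP[ca cl]].
  by move=> _ _; exists 0.
have /and3P[pa sa /forallP ka] := ca.
rewrite bars_cons size_dsum => cs; rewrite /dsum take_cat drop_cat.
case: ltnP => ac pt.
  case: c ac cs pt => [|c] ac cs pt.
    exists 0; split=> //=; first by rewrite take0.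
    by rewrite drop0 bars_cons /shift [RHS]map_id_in.
  by case/negP: (ka (Ordinal ac)); move: pt; rewrite /is_perm (size_takel (ltnW ac)).
move: pt; rewrite -map_take is_perm_dsumr // => pt.
have [|i [il ti di]] := IH (c - size a) cl _ pt; first by lia.
exists i.+1; split=> //=; first by rewrite ti bars_cons.
by rewrite -map_drop di -/(shift _ _) shift_shift subnKC.
Qed.

(** The entries of an occurrence that fall in [a] are smaller than the others, so
    they form an initial permutation of the pattern, that is, whole factors. *)
Lemma contains_dsum a b (l : seq (seq nat)) :
  is_perm a -> is_perm b -> all complete l ->
  contains (dsum a b) (bars l) <->
  exists i, [/\ i <= size l, contains a (bars (take i l))
              & contains b (bars (drop i l))].
Proof.
move=> pa pb cl; apply: (iff_trans (contains_cat _ (dsum_before pa pb))).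
split=> [[c [cs bc ac]]|[i [il ai bi]]].
  have pt : is_perm (take c (bars l)).
    by rewrite /is_perm size_takel // perm_take_before // bars_perm.
  have [i [il ti di]] := take_bars_perm cl cs pt.
  rewrite contains_shift di (contains_same_order _ (same_order_shift _ _)) => bc'.
  by exists i; rewrite -ti.
have [c1 c2] : all complete (take i l) /\ all complete (drop i l).
  by apply/andP; rewrite -all_cat cat_take_drop.
exists (size (bars (take i l))).
have -> : bars l = dsum (bars (take i l)) (bars (drop i l)).
  by rewrite -bars_cat cat_take_drop.
rewrite size_dsum leq_addr take_size_cat // drop_size_cat //.
rewrite dsum_before ?bars_perm // contains_shift.
by rewrite (contains_same_order _ (same_order_shift _ _)).
Qed.

Definition bracket (t : seq nat) : seq nat :=
  (size t).+2 :: rcons (shift 1 t) 1.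

(** On permutations, [overline] is [strip_min] followed by [strip_max], up to
    order isomorphism.  The two are defined on arbitrary words because removing
    the trailing 1 of a permutation does not leave a permutation. *)
Definition strip_max (s : seq nat) : seq nat :=
  if s is x :: q then (if all (gtn x) q then q else s) else [::].

Definition strip_min (s : seq nat) : seq nat :=
  if s is x :: q then
    (if all (ltn (last x q)) (belast x q) then belast x q else s)
  else [::].

Lemma contains1 x y : contains [:: x] [:: y].
Proof.
apply/containsP; exists [:: x] => //; apply/same_orderP; split=> // i j.
by rewrite !ltnS !leqn0 => /eqP-> /eqP->; rewrite !ltnn.
Qed.

(** An entry that dominates all later ones can only be used as the first entry of
    the pattern, which must then dominate its own later entries. *)
Lemma contains_cons_max M a s : all (gtn M) a ->
  contains (M :: a) s = contains a (strip_max s).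
Proof.
move=> aM; have h : allrel (before false) [:: M] a by rewrite allrel1l.
apply/idP/idP=> [/(contains_cat _ h)|].
  (* The first [c] entries of the pattern are those played by [M]. *)
  case=> [[|[|c]]] [cs rs ha hb].
  - rewrite drop0 in hb; case: s {cs rs ha} hb => [|x q] //= hb.
    by case: ifP => // _; have := contains_drop 1 hb; rewrite /= drop0.
  - case: s cs rs {ha} hb => [//|x q] _ /=.
    by rewrite take0 drop0 allrel1l => ->.
  - by have := contains_size ha; rewrite size_takel.
move=> hs; apply/(contains_cat _ h).
have c0 : contains a s -> exists c, [/\ c <= size s,
    allrel (before false) (take c s) (drop c s),
    contains [:: M] (take c s) & contains a (drop c s)].
  by exists 0; rewrite take0 drop0 contains0.
case: s hs c0 => [|x q] /=; first by move=> hs; apply.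
case: ifP => [xq hs _|_ hs]; last by apply.
by exists 1; rewrite /= take0 drop0 allrel1l contains1.
Qed.

Lemma contains_rcons_min m a s : all (ltn m) a ->
  contains (rcons a m) s = contains a (strip_min s).
Proof.
move=> am; have h : allrel (before false) a [:: m] by rewrite allrel1r.
rewrite -cats1; apply/idP/idP=> [/(contains_cat _ h)|].
  case=> [c [cs rs ha hb]].
  have cs1 : size s <= c.+1 by have := contains_size hb; rewrite size_drop /=; lia.
  case: s => [|x q] /= in cs rs ha hb cs1 *; first exact: contains0.
  have [cE|cE] := eqVneq c (size q).+1.
    rewrite take_oversize /= ?cE // in ha.
    case: ifP => // _; have := contains_take (size q) ha.
    by rewrite lastI -cats1 take_size_cat ?size_belast.
  have {cs cs1 cE} cE : c = size q by lia.
  move: rs ha; rewrite {}cE lastI -cats1 take_size_cat ?size_belast //.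
  rewrite drop_size_cat ?size_belast // allrel1r /=.
  by move=> /= ->.
move=> hs; apply/(contains_cat _ h).
have c0 : contains a s -> exists c, [/\ c <= size s,
    allrel (before false) (take c s) (drop c s),
    contains a (take c s) & contains [:: m] (drop c s)].
  by exists (size s); rewrite take_size drop_size contains0 allrel0r.
case: s hs c0 => [|x q] /=; first by move=> hs; apply.
case: ifP => [xq hs _|_ hs]; last by apply.
exists (size q); rewrite leqnSn.
rewrite lastI -cats1 take_size_cat ?size_belast // drop_size_cat ?size_belast //.
by rewrite allrel1r /= contains1.
Qed.

(** Both ends of [bracket t] are extreme in position and in value, so each of them
    absorbs a leading maximum, respectively a trailing minimum, of the pattern. *)
Lemma contains_bracket t s : is_perm t -> is_perm s ->
  contains (bracket t) s = contains t (overline s).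
Proof.
move=> pt ps; rewrite /bracket -rcons_cons contains_rcons_min; last first.
  apply/allP=> x; rewrite inE => /orP[/eqP->//|/mapP[y]].
  by rewrite is_perm_mem //= => yt ->; lia.
rewrite contains_cons_max; last first.
  by apply/allP=> x /mapP[y]; rewrite is_perm_mem //= => yt ->; lia.
rewrite contains_shift.
have mem (x : nat) : (x \in s) = (0 < x <= size s) by apply: is_perm_mem.
have us := is_perm_uniq ps.
have predn_mono r : {subset r <= s} -> same_order (map predn r) r.
  move=> rs; apply: same_order_map => x y /rs + /rs.
  by rewrite !mem; lia.
case: s ps mem us predn_mono => [|x s] //= ps mem us predn_mono.
case: (lastP s) ps mem us predn_mono => [|q z] ps mem us predn_mono.
  by rewrite /overline /= contains0.
rewrite belast_rcons last_rcons.
have sz : size (x :: rcons q z) = (size q).+2 by rewrite /= size_rcons.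
have -> : overline (x :: rcons q z) =
   if x == (size q).+2
   then if z == 1 then map predn q else rcons q z
   else if z == 1 then map predn (x :: q) else x :: rcons q z.
  have tq : take (size q) (rcons q z) = q by rewrite -cats1 take_size_cat.
  rewrite /overline sz /= last_rcons tq.
  by case: eqP; case: eqP.
rewrite size_rcons in mem; case/andP: us => xqz; rewrite rcons_uniq => /andP[zq uq].
have memE y : (y == x) || (y == z) || (y \in q) = (0 < y <= (size q).+2).
  by rewrite -mem inE mem_rcons inE -orbA.
have xz : x != z by apply: contraNneq xqz => ->; rewrite mem_rcons mem_head.
have xq : x \notin q by apply: contra xqz; rewrite mem_rcons inE orbC => ->.
have xN : 0 < x <= (size q).+2 by rewrite -memE eqxx.
have zN : 0 < z <= (size q).+2 by rewrite -memE eqxx orbT.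
have minE : all (ltn z) (x :: q) = (z == 1).
  apply/allP/eqP=> [h|z1 y yxq].
    have := memE 1; rewrite /= => /orP[/orP[/eqP x1|/eqP->//]|q1].
      by have := h x (mem_head _ _); rewrite /=; lia.
    by have := h 1; rewrite inE q1 orbT /= => /(_ isT); lia.
  have yz : y != z.
    by apply: contraTneq yxq => ->; rewrite inE eq_sym negb_or xz.
  have : 0 < y <= (size q).+2.
    by rewrite -memE; move: yxq; rewrite inE => /orP[]->; rewrite ?orbT.
  by rewrite /=; lia.
have maxE : all (gtn x) (rcons q z) = (x == (size q).+2).
  apply/allP/eqP=> [h|xE y yqz].
    have := memE (size q).+2; rewrite leqnn => /orP[/orP[/eqP->//|/eqP z1]|q1].
      by have := h z; rewrite mem_rcons mem_head /= => /(_ isT); lia.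
    by have := h (size q).+2; rewrite mem_rcons inE q1 orbT /= => /(_ isT); lia.
  have yx : y != x by apply: contraNneq xqz => <-.
  have : 0 < y <= (size q).+2.
    by rewrite -memE; move: yqz; rewrite mem_rcons inE => /orP[]->; rewrite ?orbT.
  by rewrite /=; lia.
have maxE' : z = 1 -> all (gtn x) q = (x == (size q).+2).
  move=> z1; rewrite -maxE all_rcons /= z1.
  by have -> : 1 < x by move: xz; lia.
rewrite minE; case: (eqVneq z 1) => z1 /=.
  rewrite maxE' //; case: eqP => _; apply/esym/contains_same_order.
    apply: (predn_mono q) => y yq.
    by rewrite inE mem_rcons inE yq !orbT.
  apply: (predn_mono (x :: q)) => y.
  by rewrite !inE mem_rcons inE => /orP[]->; rewrite ?orbT.
by rewrite maxE.
Qed.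

(** * Involutions avoiding 3412 *)

(** Entries are indexed from 1, and the extra value 0 at index 0 is a fixed point:
    so an involutive word satisfies [entry w (entry w i) = i] for all
    [i <= size w]. *)
Definition entry (w : seq nat) (i : nat) : nat := nth 0 (0 :: w) i.

Definition involutive_word (w : seq nat) : bool :=
  [forall i : 'I_(size w).+1, entry w (entry w i) == i].

Lemma involutiveP w :
  reflect (forall i, i <= size w -> entry w (entry w i) = i) (involutive_word w).
Proof.
apply: (iffP forallP) => [h i li|h i]; last by rewrite h // -ltnS.
by have /eqP := h (Ordinal (li : i < (size w).+1)).
Qed.

Definition invol3412 (w : seq nat) : bool :=
  [&& is_perm w, involutive_word w & avoids w [:: 3; 4; 1; 2]].

Lemma entry_range w i : is_perm w -> 0 < i <= size w -> 0 < entry w i <= size w.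
Proof.
by case: i => // i pw li; rewrite -is_perm_mem //; apply: mem_nth.
Qed.

Lemma entry_dsum a b i : i <= size a + size b ->
  entry (dsum a b) i =
  if i <= size a then entry a i else size a + entry b (i - size a).
Proof.
case: i => // i li; rewrite /entry /= nth_cat ltnNge; case: ltnP => //= ai.
by rewrite (nth_map 0) ?subSn //; lia.
Qed.

Lemma involutive_dsum a b : is_perm a -> is_perm b ->
  involutive_word (dsum a b) = involutive_word a && involutive_word b.
Proof.
move=> pa pb.
have atE i : i <= size a + size b -> entry (dsum a b) (entry (dsum a b) i) =
    if i <= size a then entry a (entry a i)
    else size a + entry b (entry b (i - size a)).
  move=> li; rewrite (entry_dsum li); case: (leqP i (size a)) => ia.
    have ha : entry a i <= size a.
      by case: i ia {li} => // i ia; have := @entry_range a i.+1 pa ia; lia.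
    by rewrite entry_dsum ?ha //; lia.
  have hb : 0 < entry b (i - size a) <= size b by apply: entry_range; lia.
  by rewrite entry_dsum ?ifN; [congr (_ + entry b _)|..]; lia.
apply/involutiveP/andP => [h|[/involutiveP ha /involutiveP hb]].
  rewrite size_dsum in h; split; apply/involutiveP=> i li.
    by have := h i; rewrite atE ?li; [apply|]; lia.
  case: (posnP i) => [->//|i0]; have := h (size a + i); rewrite atE; last lia.
  by rewrite ifN ?addKn; lia.
move=> i; rewrite size_dsum => li; rewrite atE //; case: leqP => ia.
  exact: ha.
by rewrite hb; lia.
Qed.

(** The pattern 3412 is complete, so an occurrence of it in a direct sum lies in
    one of the two summands. *)
Lemma invol3412_dsum a b : is_perm a -> is_perm b ->
  invol3412 (dsum a b) = invol3412 a && invol3412 b.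
Proof.
move=> pa pb; rewrite /invol3412 pa pb is_perm_dsumr // pb.
rewrite involutive_dsum // /avoids.
have c3412 : all complete [:: [:: 3; 4; 1; 2]].
  by rewrite /= andbT; apply/and3P; split=> //; apply/forallP=> -[[|[|[|[|]]]]].
have -> : contains (dsum a b) [:: 3; 4; 1; 2] =
          contains a [:: 3; 4; 1; 2] || contains b [:: 3; 4; 1; 2].
  have b1 : bars [:: [:: 3; 4; 1; 2]] = [:: 3; 4; 1; 2] by [].
  rewrite -b1; apply/idP/orP => [/(contains_dsum pa pb c3412)|ab].
    case=> i [i1 ha hb]; case: i i1 ha hb => [|[|//]] _; last by left.
    by right.
  apply/(contains_dsum pa pb c3412); case: ab => h; [exists 1|exists 0].
    by rewrite contains0.
  by rewrite contains0 drop0.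
by rewrite negb_or /=; do 2?[case: (involutive_word _)]; rewrite /= ?andbF.
Qed.

Lemma size_bracket t : size (bracket t) = (size t).+2.
Proof. by rewrite /= size_rcons size_map. Qed.

Lemma is_perm_bracket t : is_perm t -> is_perm (bracket t).
Proof.
move=> pt; have ut := is_perm_uniq pt.
have m (x : nat) :
    x \in bracket t = [|| x == (size t).+2, x == 1 | (1 < x < (size t).+2)].
  rewrite inE mem_rcons inE; congr [|| _, _ | _].
  apply/mapP/idP => [[y]|h]; first by rewrite is_perm_mem //; lia.
  by exists x.-1; rewrite ?is_perm_mem //; lia.
apply/is_permP; split; last by move=> x; rewrite m size_bracket; lia.
rewrite /= mem_rcons inE rcons_uniq map_inj_uniq ?ut ?andbT; last exact: addnI.
by apply/andP; split; [apply/norP; split=> //|]; apply/mapP=> -[y];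
  rewrite is_perm_mem //; lia.
Qed.

Lemma entry_bracket t i : 0 < i <= size t ->
  entry (bracket t) i.+1 = (entry t i).+1.
Proof.
case: i => // i li; rewrite /entry /= nth_rcons size_map ifT; last lia.
by rewrite (nth_map 0); lia.
Qed.

Lemma entry_bracket_last t : entry (bracket t) (size t).+2 = 1.
Proof. by rewrite /entry /= nth_rcons size_map ltnn eqxx. Qed.

Lemma involutive_bracket t :
  is_perm t -> involutive_word (bracket t) = involutive_word t.
Proof.
move=> pt.
have atE i : 0 < i <= size t ->
    entry (bracket t) (entry (bracket t) i.+1) = (entry t (entry t i)).+1.
  by move=> li; rewrite !entry_bracket ?entry_range.
apply/involutiveP/involutiveP; rewrite size_bracket => h i li.
  case: (posnP i) => [->//|i0]; apply: succn_inj; rewrite -atE; last lia.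
  by apply: h; lia.
case: i li => [|[|i]] li //; first exact: entry_bracket_last.
have [->|i2] := eqVneq i (size t); first by rewrite entry_bracket_last.
by rewrite atE ?h; lia.
Qed.

(** As 3412 neither begins with its maximum nor ends with its minimum,
    [overline] fixes it. *)
Lemma invol3412_bracket t : is_perm t -> invol3412 (bracket t) = invol3412 t.
Proof.
move=> pt; rewrite /invol3412 is_perm_bracket // pt involutive_bracket //.
by rewrite /avoids contains_bracket.
Qed.

Lemma invol3412_1 : invol3412 [:: 1].
Proof.
apply/and3P; split=> //; last by apply/negP=> /contains_size.
by apply/involutiveP=> -[|[|]].
Qed.

Lemma invol3412_0 : invol3412 [::].
Proof.
apply/and3P; split=> //; last by apply/negP=> /contains_size.
by apply/involutiveP=> -[].
Qed.

Lemma subseq_nth w s : sorted ltn s -> all (gtn (size w)) s ->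
  subseq [seq nth 0 w i | i <- s] w.
Proof.
move=> ss sw; rewrite -{2}(mkseq_nth 0 w); apply: map_subseq.
have -> : s = [seq i <- iota 0 (size w) | i \in s]; last exact: filter_subseq.
apply: (irr_sorted_eq ltn_trans ltnn) => //.
  by rewrite (sorted_filter ltn_trans) // iota_ltn_sorted.
move=> i; rewrite mem_filter mem_iota; case is_: (i \in s) => //=.
by have /= := allP sw _ is_; lia.
Qed.

(** Write [K] for the first value.  If a position [I] with [1 < I < K] held a
    value [V > K], the entries of the involution at the positions
    [1 < I < K < V] would be [K, V, 1, I], an occurrence of 3412. *)
Lemma take_head_perm w k : invol3412 w -> nth 0 w 0 = k.+1 -> is_perm (take k.+1 w).
Proof.
case/and3P=> pw /involutiveP iw aw w0.
have sw : 0 < size w by case: (w) w0.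
have kw : k.+1 <= size w.
  by have := @entry_range w 1 pw; rewrite /entry /= w0 sw => /(_ isT).
have wk : nth 0 w k = 1 by have := iw 1 sw; rewrite {2}/entry /= w0.
apply/is_permP; rewrite size_takel //; split.
  by rewrite take_uniq // is_perm_uniq.
move=> x /(nthP 0)[i]; rewrite size_takel // => ik; rewrite nth_take // => xE.
have := @entry_range w i.+1 pw; rewrite /entry /= xE.
move=> /(_ (leq_trans ik kw))/andP[-> xw].
rewrite leqNgt; apply/negP=> kx; case/negP: aw.
have wx : nth 0 w x.-1 = i.+1.
  have := iw i.+1; rewrite {2}/entry /= xE.
  by case: x {xE xw} kx => //= x _; apply; lia.
have i0 : i != 0 by apply: contraTneq kx => i0; rewrite -xE i0 w0 ltnn.
have ik' : i != k by apply: contraTneq kx => i0'; rewrite -xE i0' wk.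
apply/containsP; exists [seq nth 0 w j | j <- [:: 0; i; k; x.-1]].
  by apply: subseq_nth; rewrite /= ?andbT; lia.
rewrite /= w0 xE wk wx; apply/same_orderP; split=> //.
by move=> [|[|[|[|a]]]] [|[|[|[|b]]]] //= _ _; lia.
Qed.

Lemma invol3412_block a k : invol3412 a -> size a = k.+2 -> nth 0 a 0 = k.+2 ->
  exists2 t, is_perm t & a = bracket t.
Proof.
case/and3P=> pa /involutiveP ia _ sa a0.
have ak : nth 0 a k.+1 = 1.
  by have := ia 1; rewrite sa {2}/entry /= a0; apply.
case: a {ia} => // x a in pa sa a0 ak *; case: (lastP a) sa pa ak => // q z.
rewrite /= size_rcons => -[sq] pa; rewrite nth_rcons sq ltnn eqxx => z1.
move: a0 pa => /= ->; rewrite {}z1 => {x z a} pa.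
have mem (y : nat) := is_perm_mem y pa; have := is_perm_uniq pa.
rewrite /= rcons_uniq mem_rcons inE => /andP[/norP[_ kq] /andP[q1 uq]].
have q_range (y : nat) : y \in q -> 1 < y < k.+2.
  move=> yq; have := mem y; rewrite /= size_rcons sq inE mem_rcons inE yq !orbT.
  have : y != k.+2 by apply: contraNneq kq => <-.
  have : y != 1 by apply: contraNneq q1 => <-.
  by lia.
exists (map predn q).
  apply/is_permP; rewrite size_map; split.
    rewrite map_inj_in_uniq // => y y' /q_range yr /q_range yr'; lia.
  by move=> y /mapP[y' /q_range yr ->]; lia.
rewrite /bracket size_map sq; congr (_ :: rcons _ _).
by rewrite /shift -map_comp map_id_in // => y /q_range /=; lia.
Qed.

Definition words n : seq (seq nat) :=
  [seq word s | s <- enum (invol_avoiding n fset0)].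

Lemma size_word n (s : 'S_n) : size (word s) = n.
Proof. by rewrite size_map size_enum_ord. Qed.

Lemma nth_word n (s : 'S_n) (i : 'I_n) : nth 0 (word s) i = (s i).+1.
Proof. by rewrite (nth_map i) ?size_enum_ord // nth_ord_enum. Qed.

Lemma word_inj n : injective (@word n).
Proof.
move=> s s' ss'; apply/permP=> i; apply: val_inj; apply: succn_inj.
by rewrite -!nth_word ss'.
Qed.

Lemma is_perm_word n (s : 'S_n) : is_perm (word s).
Proof.
apply/is_permP; rewrite size_word; split.
  rewrite map_inj_uniq ?enum_uniq // => i j /succn_inj/val_inj.
  exact: perm_inj.
by move=> x /mapP[i _ ->] /=.
Qed.

Lemma involutive_perm_word n (s : 'S_n) : involutive_word (word s) = (s * s == 1)%g.
Proof.
have atE (i : 'I_n) : entry (word s) i.+1 = (s i).+1 by rewrite /entry /= nth_word.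
apply/involutiveP/eqP => [h|h i].
  apply/permP=> i; apply: val_inj; apply: succn_inj.
  by rewrite permM perm1 -!atE h // size_word.
rewrite size_word; case: i => // i li.
by rewrite (atE (Ordinal li)) atE -permM h perm1.
Qed.

Lemma word_surj n w : is_perm w -> size w = n -> exists s : 'S_n, w = word s.
Proof.
move=> pw sw; have ltn i : i < n -> (nth 0 w i).-1 < n.
  move=> li; have : nth 0 w i \in w by rewrite mem_nth ?sw.
  by rewrite is_perm_mem // sw; lia.
pose f (i : 'I_n) := Ordinal (ltn i (ltn_ord i)).
have f_inj : injective f.
  move=> i j /(congr1 val) /= fij; apply/ord_inj/eqP.
  have mi (l : 'I_n) : nth 0 w l \in w by rewrite mem_nth ?sw.
  have wij : nth 0 w i = nth 0 w j.
    by have := mi i; have := mi j; rewrite !is_perm_mem //; lia.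
  by rewrite -(nth_uniq 0 _ _ (is_perm_uniq pw)) ?sw // wij.
exists (perm f_inj); apply: (@eq_from_nth _ 0); first by rewrite size_word.
move=> i; rewrite sw => li; rewrite (nth_word _ (Ordinal li)) permE /=.
have : nth 0 w i \in w by rewrite mem_nth ?sw.
by rewrite is_perm_mem //; lia.
Qed.

Lemma mem_words n w : (w \in words n) = (size w == n) && invol3412 w.
Proof.
apply/mapP/andP => [[s]|[/eqP sw /and3P[pw iw aw]]].
  rewrite mem_enum inE => /and3P[ss as_ _] ->.
  by rewrite size_word eqxx /invol3412 is_perm_word involutive_perm_word ss as_.
have [s wE] := word_surj pw sw; exists s => //; rewrite mem_enum inE.
rewrite -involutive_perm_word -wE iw aw /=; apply/forallP=> -[t ht].
have : (t \in (fset0 : {fset seq nat})) = false by rewrite in_fset0.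
by move/(etrans (esym ht)).
Qed.

Lemma words_uniq n : uniq (words n).
Proof. by rewrite map_inj_uniq ?enum_uniq //; apply: word_inj. Qed.

(** The involutions avoiding 3412 of length [k+1] that begin with their largest
    value; see [mem_blocks]. *)
Definition blocks k : seq (seq nat) :=
  if k is k'.+1 then map bracket (words k') else [:: [:: 1]].

Lemma bracket_inj : injective bracket.
Proof.
move=> t t' [_ /eqP]; rewrite eqseq_rcons eqxx andbT => /eqP.
by apply: inj_map; apply: addnI.
Qed.

Lemma blocks_uniq k : uniq (blocks k).
Proof.
case: k => //= k; rewrite map_inj_uniq ?words_uniq //.
exact: bracket_inj.
Qed.

Lemma mem_blocks k a :
  (a \in blocks k) = [&& size a == k.+1, invol3412 a & nth 0 a 0 == k.+1].
Proof.
case: k => [|k] /=.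
  rewrite inE; apply/eqP/and3P => [->|]; first by rewrite invol3412_1.
  by case=> /eqP + _ /eqP; case: a => [|x [|]] //= _ ->.
apply/mapP/and3P => [[t]|[/eqP sa ga /eqP a0]].
  rewrite mem_words => /andP[/eqP <- gt] ->.
  have pt : is_perm t by case/and3P: gt.
  by rewrite size_bracket eqxx invol3412_bracket.
have [t pt aE] := invol3412_block ga sa a0; exists t => //.
rewrite mem_words -(invol3412_bracket pt) -aE ga andbT.
by move: sa; rewrite aE size_bracket => -[->].
Qed.

Lemma invol3412_perm w : invol3412 w -> is_perm w.
Proof. by case/and3P. Qed.

(** The first value [k+1] delimits the first summand. *)
Lemma words_by_head n k : k <= n ->
  perm_eq [seq w <- words n.+1 | nth 0 w 0 == k.+1]
          [seq dsum a b | a <- blocks k, b <- words (n - k)].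
Proof.
move=> kn; apply: uniq_perm.
- by rewrite filter_uniq // words_uniq.
- apply: allpairs_uniq; rewrite ?blocks_uniq ?words_uniq // => -[a b] [a' b'].
  case/allpairsP=> -[? ?] [/= + _ [-> _]].
  rewrite mem_blocks => /and3P[/eqP sa _ _].
  case/allpairsP=> -[? ?] [/= + _ [-> _]].
  rewrite mem_blocks => /and3P[/eqP sa' _ _].
  rewrite /dsum => /eqP; rewrite eqseq_cat ?sa ?sa' // => /andP[/eqP -> /eqP].
  by move=> /(inj_map (@addnI _)) ->.
move=> w; rewrite mem_filter mem_words; apply/and3P/allpairsP.
  case=> /eqP w0 /eqP sw gw; have pt := take_head_perm gw w0.
  have st : size (take k.+1 w) = k.+1 by rewrite size_takel ?sw.
  have [b pb wE] := dsum_take (invol3412_perm gw) pt.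
  move: gw; rewrite {1}wE invol3412_dsum // => /andP[ga gb].
  exists (take k.+1 w, b); split=> //=.
    by rewrite mem_blocks st eqxx ga nth_take // w0 eqxx.
  have sb : size b = n - k by move: (congr1 size wE); rewrite size_dsum st sw; lia.
  by rewrite mem_words gb andbT sb.
case=> -[a b] [/=]; rewrite mem_blocks mem_words.
case/and3P=> /eqP sa ga a0 /andP[/eqP sb gb] ->.
rewrite invol3412_dsum ?invol3412_perm // size_dsum ga gb sa sb nth_cat sa.
by split; rewrite // addSn subnKC ?eqxx.
Qed.

(** * Distributing avoidance over a direct sum *)

Lemma contains_dsuml w a b : contains w (dsum a b) -> contains w a.
Proof. by move=> /(contains_take (size a)); rewrite take_size_cat. Qed.

Lemma contains_dsumr w a b : contains w (dsum a b) -> contains w b.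
Proof.
move=> /(contains_drop (size a)); rewrite drop_size_cat //.
by rewrite (contains_same_order _ (same_order_shift _ _)).
Qed.

Lemma contains_bars_take w (l : seq (seq nat)) i j : i <= j ->
  contains w (bars (take j l)) -> contains w (bars (take i l)).
Proof.
by move=> ij; rewrite -(subnKC ij) takeD bars_cat; apply: contains_dsuml.
Qed.

Lemma contains_bars_drop w (l : seq (seq nat)) i j : i <= j ->
  contains w (bars (drop i l)) -> contains w (bars (drop j l)).
Proof.
move=> ij; rewrite -{1}(cat_take_drop (j - i) (drop i l)) drop_drop subnK //.
by rewrite bars_cat; apply: contains_dsumr.
Qed.

(** The cut to test when looking for [bars l] in [dsum a b]: the prefix given to
    [a] is the longest that it contains, so [i] is determined by [a] and [l]. *)
Definition splits_at (a b : seq nat) (l : seq (seq nat)) (i : nat) : bool :=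
  [&& contains a (bars (take i l)), avoids a (bars (take i.+1 l))
    & avoids b (bars (drop i l))].

Lemma splits_at_inj a b l i j :
  splits_at a b l i -> splits_at a b l j -> i = j.
Proof.
move=> /and3P[ci ai _] /and3P[cj aj _]; case: (ltngtP i j) => // lt.
  by case/negP: ai; apply: contains_bars_take cj.
by case/negP: aj; apply: contains_bars_take ci.
Qed.

(** It is enough to test the longest prefix contained in [a], since a shorter
    prefix leaves a longer suffix to be found in [b]. *)
Lemma avoids_dsum a b (l : seq (seq nat)) :
  is_perm a -> is_perm b -> all complete l ->
  avoids (dsum a b) (bars l) = [exists i : 'I_(size l), splits_at a b l i].
Proof.
move=> pa pb cl; apply/negP/existsP => [nab|[i /and3P[_ ai bi]]]; last first.
  case/(contains_dsum pa pb cl) => j [_ aj bj]; case: (leqP j i) => ji.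
    by case/negP: bi; apply: contains_bars_drop bj.
  by case/negP: ai; apply: contains_bars_take aj.
(* The whole of [l] is not contained in [a], since [b] contains the empty
   suffix; so there is a shortest prefix that [a] avoids. *)
have ex : exists i, avoids a (bars (take i l)).
  exists (size l); apply/negP=> al; apply: nab; apply/(contains_dsum pa pb cl).
  by exists (size l); rewrite drop_size contains0.
case: (ex_minnP ex) => -[|i] ai imin; first by rewrite take0 /avoids contains0 in ai.
have ci : contains a (bars (take i l)).
  by apply: contraT => /imin; rewrite ltnn.
have il : i < size l.
  rewrite ltnNge; apply/negP=> li; case/negP: ai.
  by rewrite take_oversize ?(leqW li) // -[l in bars l](take_oversize li).
exists (Ordinal il); rewrite /splits_at ci ai /=; apply/negP=> bi.
by apply: nab; apply/(contains_dsum pa pb cl); exists i; rewrite (ltnW il).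
Qed.

(** The single entry 1 can only serve as a first factor equal to 1. *)
Lemma avoids_dsum1 b (l : seq (seq nat)) :
  is_perm b -> all complete l -> bars l <> [::] ->
  avoids (dsum [:: 1] b) (bars l) = avoids b (beta l).
Proof.
case: l => // a l pb cl _; congr (~~ _); rewrite /beta /=.
have /andP[/and3P[pa sa _] cl'] := cl.
have p1 : is_perm [:: 1] by [].
apply/idP/idP => [/(contains_dsum p1 pb cl)|].
  case=> // -[|i] [_ c1 cb].
    rewrite drop0 in cb; case: eqP => // _; move: cb.
    by rewrite bars_cons; apply: contains_dsumr.
  rewrite /= in c1 cb; have /contains_size := c1.
  rewrite bars_cons size_dsum => sz.
  have a1 : a = [:: 1].
    case: a pa sa sz {cl c1} => // x [|? ?] //= px _ _.
    by have := is_perm_mem x px; rewrite mem_head /=; case: x {px} => [|[]].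
  case: i sz c1 cb => [|i] sz c1 cb; first by rewrite a1 eqxx -(drop0 l).
  case: l {cl} cl' sz c1 cb => [|a' l] /=; first by rewrite a1.
  by case/andP=> /and3P[_ sa' _] _; rewrite bars_cons size_dsum; lia.
case: eqP => [a1|_] h; apply/(contains_dsum p1 pb cl).
  by exists 1; rewrite /= take0 drop0 a1; split=> //; apply: contains1.
by exists 0; rewrite drop0 contains0.
Qed.

Local Open Scope ring_scope.

Definition avoids_all (w : seq nat) (T : {fset seq nat}) : bool :=
  [forall t : T, avoids w (val t)].

Lemma avoids_allP w T :
  reflect (forall t, t \in T -> avoids w t) (avoids_all w T).
Proof.
apply: (iffP forallP) => [h t tT|h t]; first exact: (h [` tT]%fset).
exact/h/valP.
Qed.

Lemma avoids_all_imfset m w (q : 'I_m -> seq nat) :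
  avoids_all w [fset q j | j in 'I_m]%fset = [forall j, avoids w (q j)].
Proof.
apply/avoids_allP/forallP => [h j|h t]; first exact/h/in_imfset.
by case/imfsetP=> j _ ->.
Qed.

Lemma F_coefE T n :
  fps_coef (F T) n = \sum_(w <- words n) (avoids_all w T)%:R.
Proof.
rewrite big_map big_enum /= -sum1_card natr_sum.
under [RHS]eq_bigr do rewrite mulrb.
rewrite -big_mkcondr /=; apply: eq_bigl => s.
rewrite !inE -!andbA -/(avoids_all _ fset0).
have -> : avoids_all (word s) fset0.
  by apply/avoids_allP => t; rewrite in_fset0.
by [].
Qed.

Lemma sum_words0 (f : seq nat -> int) : \sum_(w <- words 0) f w = f [::].
Proof.
have w0 : perm_eq (words 0) [:: [::]].
  apply: uniq_perm; rewrite ?words_uniq // => w.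
  rewrite mem_words inE size_eq0; case: eqP => // ->.
  exact: invol3412_0.
by rewrite (perm_big _ w0) big_seq1.
Qed.

Lemma sum_words (f : seq nat -> int) n :
  \sum_(w <- words n.+1) f w =
  \sum_(k < n.+1) \sum_(a <- blocks k) \sum_(b <- words (n - k)) f (dsum a b).
Proof.
(* First values lie in [1..n+1], so [inord] does not identify any of them. *)
rewrite (partition_big (fun w => inord (nth 0%N w 0).-1 : 'I_n.+1) xpredT) //=.
apply: eq_bigr => k _; rewrite -big_filter.
have -> : [seq w <- words n.+1 | inord (nth 0%N w 0).-1 == k]
          = [seq w <- words n.+1 | nth 0%N w 0 == k.+1].
  apply: eq_in_filter => w; rewrite mem_words => /andP[/eqP sw /invol3412_perm pw].
  have := @entry_range w 1 pw; rewrite /entry sw /= => /(_ isT) => wr.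
  by rewrite -val_eqE /= inordK; lia.
have kn : (k <= n)%N by rewrite -ltnS.
by rewrite (perm_big _ (words_by_head kn)) big_allpairs_dep.
Qed.

Lemma prod_bool (I : finType) (c : pred I) :
  \prod_j (c j)%:R = ([forall j, c j])%:R :> int.
Proof.
case: forallP => [h|/forallP]; first by rewrite big1 // => j _; rewrite h.
by rewrite negb_forall => /existsP[j /negbTE cj]; rewrite (bigD1 j) //= cj mul0r.
Qed.

(** Since [a j] implies [b j], the indicator of [~~ a j && b j] is the difference
    [b j - a j]; the left-hand side is the expanded product of these. *)
Lemma incl_excl (I : finType) (a b : pred I) : (forall j, a j -> b j) ->
  \sum_(Y : {set I}) (-1) ^+ #|Y| *
     ([forall j, if j \in Y then a j else b j])%:R =
  ([forall j, ~~ a j && b j])%:R :> int.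
Proof.
move=> ab; rewrite -prod_bool.
under [RHS]eq_bigr => j _.
  have -> : (~~ a j && b j)%:R = - (a j)%:R + (b j)%:R :> int.
    by case: (a j) (ab j) => [/(_ isT)->|_] /=; rewrite ?addNr ?oppr0 ?add0r.
  over.
rewrite bigA_distr; apply: eq_big => Y; first by rewrite inE.
move=> _; rewrite -prod_bool -prodr_const big_mkcond -big_split /=.
by apply: eq_bigr => j _; case: ifP => _; rewrite ?mulN1r ?mul1r.
Qed.

(** Uniqueness makes the left-hand side the number, 0 or 1, of simultaneous
    choices. *)
Lemma sum_choice (I : finType) (J : I -> finType) (c : forall j, pred (J j)) :
  (forall j x y, c j x -> c j y -> x = y) ->
  \sum_(i : {dffun forall j, J j}) ([forall j, c j (i j)])%:R =
  ([forall j, [exists x, c j x]])%:R :> int.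
Proof.
move=> c_inj; case: forallP => [ex|nex].
  pose i0 : {dffun forall j, J j} := [ffun j => xchoose (existsP (ex j))].
  rewrite (bigD1 i0) //= big1 ?addr0; last first.
    move=> i ii0; case: forallP => // ci; case/eqP: ii0; apply/ffunP=> j.
    by apply: c_inj (ci j) _; rewrite ffunE; apply: xchooseP.
  by case: forallP => // -[] j; rewrite ffunE; apply: xchooseP.
rewrite big1 // => i _; case: forallP => // ci; case: nex => j.
by apply/existsP; exists (i j).
Qed.

Lemma fps_coefD (f g : fps) n : fps_coef (f + g) n = fps_coef f n + fps_coef g n.
Proof. by []. Qed.

Lemma fps_coefM (f g : fps) n :
  fps_coef (f * g) n = \sum_(k < n.+1) fps_coef f k * fps_coef g (n - k).
Proof. by []. Qed.

Lemma fps_coef_sum (I : finType) (P : pred I) (f : I -> fps) n :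
  fps_coef (\sum_(i | P i) f i) n = \sum_(i | P i) fps_coef (f i) n.
Proof. exact: (big_morph (fun g => fps_coef g n)). Qed.

Lemma fps_coef_sign k (f : fps) n :
  fps_coef ((-1) ^+ k * f) n = (-1) ^+ k * fps_coef f n.
Proof.
rewrite -signr_odd -[in RHS]signr_odd.
by case: (odd k); rewrite ?expr1 ?expr0 ?mulN1r ?mul1r.
Qed.

Lemma fps_coefX0 (f : fps) : fps_coef (fpsX * f) 0%N = 0.
Proof. by rewrite fps_coefM big_ord1 mul0r. Qed.

Lemma fps_coefXS (f : fps) n : fps_coef (fpsX * f) n.+1 = fps_coef f n.
Proof.
rewrite fps_coefM big_ord_recl mul0r add0r big_ord_recl mul1r subSS subn0.
by rewrite big1 ?addr0 // => i _; rewrite mul0r.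
Qed.

Lemma avoids_TY m (alpha : 'I_m -> seq (seq nat)) (i : index_tuple alpha) Y w :
  avoids_all w (TY alpha i Y) =
  [forall j, if j \in Y then avoids w (overline (bars (take (i j) (alpha j))))
             else avoids w (overline (bars (take (i j).+1 (alpha j))))].
Proof.
apply/avoids_allP/forallP => [h j|h t].
  by case: ifP => jY; apply: h; rewrite in_fsetU; apply/orP;
    [left|right]; apply/imfsetP; exists j; rewrite //= inE jY.
rewrite in_fsetU => /orP[]/imfsetP[j /= jY ->]; have := h j; first by rewrite jY.
by move: jY; rewrite inE => /negbTE->.
Qed.

(** The summand of index [i] is 1 when every pattern [j] splits after its first
    [i j] factors, and 0 otherwise. *)
Lemma avoids_bracket_dsum m (alpha : 'I_m -> seq (seq nat)) t b :
  is_perm t -> is_perm b -> (forall j, all complete (alpha j)) ->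
  [forall j, avoids (dsum (bracket t) b) (bars (alpha j))]%:R =
  \sum_(i : index_tuple alpha)
     (\sum_(Y : {set 'I_m}) (-1) ^+ #|Y| * (avoids_all t (TY alpha i Y))%:R)
     * (avoids_all b (Tright alpha i))%:R :> int.
Proof.
move=> pt pb ca.
under eq_forallb => j do rewrite avoids_dsum ?is_perm_bracket //.
rewrite -sum_choice; last by move=> j x y /splits_at_inj h /h /val_inj.
apply: eq_bigr => i _.
under eq_bigr => Y _ do rewrite avoids_TY.
have pp j k : is_perm (bars (take k (alpha j))).
  apply: bars_perm; have := ca j; rewrite -{1}(cat_take_drop k (alpha j)).
  by rewrite all_cat => /andP[].
rewrite incl_excl; last first.
  move=> j; rewrite /avoids -!contains_bracket //; apply: contra.
  exact: contains_bars_take.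
rewrite -natrM mulnb avoids_all_imfset; congr ((nat_of_bool _)%:R).
apply/forallP/andP => [h|[/forallP h1 /forallP h2] j].
  split; apply/forallP=> j; have := h j; rewrite /splits_at => /and3P[h1 h2 h3] //.
  by rewrite /avoids negbK -!contains_bracket // h1.
have := h1 j; rewrite /avoids negbK -!contains_bracket // => /andP[h3 h4].
by apply/and3P; split=> //; apply: h2.
Qed.

Theorem theorem5p5 (m : nat) (p : 'I_m -> seq nat)
    (alpha : 'I_m -> seq (seq nat))
    (p_perm : forall j, is_perm (p j))
    (p_nonempty : forall j, p j <> [::])
    (alpha_complete : forall j, all complete (alpha j))
    (p_alpha : forall j, p j = bars (alpha j)) :
  F [fset p j | j in 'I_m]%fset =
    1 + fpsX * F [fset beta (alpha j) | j in 'I_m]%fset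
    + fpsX ^+ 2 *
      \sum_(i : index_tuple alpha)
        (\sum_(Y : {set 'I_m}) (-1) ^+ #|Y| * F (TY alpha i Y))
        * F (Tright alpha i).
Proof.
rewrite expr2 -mulrA; apply: fpsP => -[|n].
  rewrite !fps_coefD !fps_coefX0 !addr0 F_coefE sum_words0.
  rewrite avoids_all_imfset; case: forallP => // -[j].
  by apply/negP=> /contains_size; have := p_nonempty j; case: (p j).
rewrite !fps_coefD !fps_coefXS [fps_coef 1 _]/= add0r !F_coefE.
(* The first summand has length 1 in the leading term of the recurrence, and is
   a bracket in the other terms. *)
rewrite sum_words big_ord_recl; congr (_ + _).
  rewrite /= big_seq1 subn0; apply: eq_big_seq => b.
  rewrite mem_words => /andP[_ /invol3412_perm pb].
  rewrite !avoids_all_imfset; congr ((nat_of_bool _)%:R).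
  apply: eq_forallb => j; rewrite p_alpha avoids_dsum1 // -p_alpha.
  exact: p_nonempty.
case: n => [|n]; first by rewrite big_ord0 fps_coefX0.
rewrite fps_coefXS fps_coef_sum.
under [RHS]eq_bigr => i _ do rewrite fps_coefM.
rewrite exchange_big; apply: eq_bigr => k _.
rewrite lift0 subSS [blocks _]/= big_map.
under [RHS]eq_bigr => i _.
  rewrite fps_coef_sum F_coefE.
  under eq_bigr => Y _ do rewrite fps_coef_sign F_coefE big_distrr.
  rewrite exchange_big /= big_distrlr /=.
  over.
rewrite [RHS]exchange_big /=; apply: eq_big_seq => t.
rewrite mem_words => /andP[_ /invol3412_perm pt].
rewrite [RHS]exchange_big /=; apply: eq_big_seq => b.
rewrite mem_words => /andP[_ /invol3412_perm pb].
rewrite avoids_all_imfset -avoids_bracket_dsum //.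
by congr ((nat_of_bool _)%:R); apply: eq_forallb => j; rewrite p_alpha.
Qed.
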